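(* Let $n>1$ be an integer. There exists no $(2n+1)$-dimensional $\phi$-recurrent contact metric manifold of constant curvature.
   Context: Manifolds are smooth and non-empty. A contact metric manifold is a $(2n+1)$-dimensional manifold $M$ with a 1-form $\eta$ satisfying $\eta\wedge(d\eta)^n\neq 0$ everywhere, the characteristic vector field $\xi$ (determined by $\eta(\xi)=1$, $d\eta(\xi,\cdot)=0$), a Riemannian metric $g$ and a $(1,1)$-tensor field $\phi$ such that for all vector fields $X,Y$: $\eta(X)=g(X,\xi)$, $d\eta(X,Y)=g(X,\phi Y)$, $\phi^2X=-X+\eta(X)\xi$. Convention: $d\eta(X,Y)=\frac12\big(X\eta(Y)-Y\eta(X)-\eta([X,Y])\big)$. Let $\nabla$ be the Levi-Civita connection of $g$ and $R(X,Y)Z=\nabla_X\nabla_YZ-\nabla_Y\nabla_XZ-\nabla_{[X,Y]}Z$. A contact metric manifold is $\phi$-recurrent if there exists a non-zero 1-form $A$ (i.e. not identically zero) such that $\phi^2((\nabla_WR)(X,Y)Z)=A(W)R(X,Y)Z$ for all vector fields $X,Y,Z,W$ (not necessarily orthogonal to $\xi$). Constant curvature means that there is a real constant $\lambda$ such that $R(X,Y)Z=\lambda(g(Y,Z)X-g(X,Z)Y)$ for all vector fields $X,Y,Z$. *)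

(* Defs.v *)
From HB Require Import structures.
From mathcomp Require Import all_boot all_order all_algebra perm.
From mathcomp Require Import all_classical reals topology normedtype derive.
From mathcomp Require Import ring.

Set Implicit Arguments.
Unset Strict Implicit.
Unset Printing Implicit Defensive.

Import Order.TTheory GRing.Theory Num.Theory.
Import numFieldNormedType.Exports.

Local Open Scope classical_set_scope.
Local Open Scope ring_scope.

Section EuclideanSmoothness.
Variables (R : realType) (m : nat).
Local Notation E := 'rV[R]_m.
Implicit Types (U : set E) (f g : E -> R^o).

(* Only meaningful for U open: the directional derivative 'D_v f x involves
   the values of f near x. *)
Fixpoint Ck_on (k : nat) U f : Prop :=
  (forall x, U x -> {for x, continuous f}) /\
  if k is k'.+1 then
    forall i : 'I_m, (forall x, U x -> derivable f x (delta_mx 0 i)) /\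
                     Ck_on k' U ('D_(delta_mx 0 i) f)
  else True.

Definition smooth_on U f : Prop := forall k, Ck_on k U f.

Lemma Ck_on_ext k U f g : open U -> (forall x, U x -> f x = g x) ->
  Ck_on k U f -> Ck_on k U g.
Proof.
move=> oU.
have nearU x h1 h2 : (forall x, U x -> h1 x = h2 x :> R^o) -> U x ->
    \forall y \near x, h1 y = h2 y.
  by move=> e Ux; near=> y; apply: e; near: y; apply: open_nbhs_nbhs.
have cont f1 f2 : (forall x, U x -> f1 x = f2 x) ->
    (forall x, U x -> {for x, continuous f1}) ->
    forall x, U x -> {for x, continuous f2}.
  move=> e c1 x Ux; rewrite /prop_for /continuous_at -(e x Ux).
  apply: cvg_trans (c1 x Ux).
  exact: (near_eq_cvg (FF := nbhs_filter x) (nearU x f1 f2 e Ux)).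
elim: k f g => [|k IH] f g efg [cf df]; split.
- exact: cont efg cf.
- by [].
- exact: cont efg cf.
- move=> i; have [dfi Dfi] := df i; split.
    by move=> x Ux; apply: near_eq_derivable (dfi x Ux); exact: nearU.
  apply: IH Dfi => x Ux; apply: near_eq_derive; exact: nearU.
Unshelve. all: by end_near. Qed.

Lemma Ck_onW k U f : Ck_on k.+1 U f -> Ck_on k U f.
Proof.
elim: k f => [|k IH] f [cf df]; split => // i.
by have [dfi Dfi] := df i; split=> //; apply: IH.
Qed.

Lemma Ck_on_cst k U (c : R) : Ck_on k U (fun=> c).
Proof.
elim: k c => [|k IH] c; split=> //.
- by move=> x _; exact: cst_continuous.
- by move=> x _; exact: cst_continuous.
- move=> i; split; first by move=> x _; exact: derivable_cst.
  rewrite (_ : 'D_(delta_mx 0 i) _ = fun=> 0); first exact: IH.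
  by apply/funext => x; rewrite derive_cst.
Qed.

Lemma Ck_onD k U f g : open U -> Ck_on k U f -> Ck_on k U g ->
  Ck_on k U (f + g).
Proof.
move=> oU; elim: k f g => [|k IH] f g [cf df] [cg dg]; split => //.
- by move=> x Ux; apply: continuousD; [exact: cf|exact: cg].
- by move=> x Ux; apply: continuousD; [exact: cf|exact: cg].
- move=> i; have [dfi Dfi] := df i; have [dgi Dgi] := dg i; split.
    by move=> x Ux; apply: derivableD; [exact: dfi|exact: dgi].
  apply: Ck_on_ext (IH _ _ Dfi Dgi) => // x Ux.
  by rewrite deriveD; [| exact: dfi | exact: dgi].
Qed.

Lemma Ck_onM k U f g : open U -> Ck_on k U f -> Ck_on k U g ->
  Ck_on k U (f * g).
Proof.
move=> oU; elim: k f g => [|k IH] f g; first case=> [cf df] [cg dg].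
  by split => // x Ux; apply: continuousM; [exact: cf|exact: cg].
move=> hf hg; have [cf df] := hf; have [cg dg] := hg; split.
  by move=> x Ux; apply: continuousM; [exact: cf|exact: cg].
move=> i; have [dfi Dfi] := df i; have [dgi Dgi] := dg i; split.
  by move=> x Ux; apply: derivableM; [exact: dfi|exact: dgi].
apply: (@Ck_on_ext _ _ (f * 'D_(delta_mx 0 i) g + g * 'D_(delta_mx 0 i) f)).
- exact: oU.
- by move=> x Ux; rewrite deriveM; [| exact: dfi | exact: dgi].
- by apply: Ck_onD => //; apply: IH => //; exact: Ck_onW.
Qed.

End EuclideanSmoothness.

(* cmap is only relevant on the open set cdom, and cinv only on its image. *)
Record chart (R : realType) (m : nat) (T : topologicalType) := Chart {
  cdom : set T;
  cmap : T -> 'rV[R]_m;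
  cinv : 'rV[R]_m -> T;
  cdom_open : open cdom;
  cimg_open : open (cmap @` cdom);
  cmapK : forall x, cdom x -> cinv (cmap x) = x;
  cmap_continuous : forall x, cdom x -> {for x, continuous cmap};
  cinv_continuous : forall y, (cmap @` cdom) y -> {for y, continuous cinv} }.

Definition smooth_transition (R : realType) (m : nat) (T : topologicalType)
    (c d : chart R m T) : Prop :=
  forall i : 'I_m, smooth_on (cmap c @` (cdom c `&` cdom d))
                             (fun y => cmap d (cinv c y) 0 i).

Record manifold (R : realType) (m : nat) := Manifold {
  carrier :> topologicalType;
  atlas : set (chart R m carrier);
  manifold_nonempty : [set: carrier] !=set0;
  manifold_hausdorff : hausdorff_space carrier;
  manifold_second_countable : @second_countable carrier;
  atlas_cover : forall x : carrier, exists2 c, atlas c & cdom c x;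
  atlas_smooth : forall c d, atlas c -> atlas d -> smooth_transition c d }.

Section SmoothFunctions.
Variables (R : realType) (m : nat) (M : manifold R m).

Definition smooth (f : M -> R) : Prop :=
  forall c, atlas c -> smooth_on (cmap c @` cdom c) (f \o cinv c).

Definition smooth_pred : {pred M -> R} := [pred f | `[< smooth f >]].

Record smooth_fun := SmoothFun {
  smooth_val :> M -> R;
  smooth_valP : smooth_val \in smooth_pred }.

HB.instance Definition _ := [isSub for smooth_val].
HB.instance Definition _ := [Choice of smooth_fun by <:].

Fact smooth_subring_closed : subring_closed smooth_pred.
Proof.
have S (f : M -> R) : reflect (smooth f) (f \in smooth_pred).
  by rewrite inE; exact: asboolP.
have scst (a : R) : smooth (fun=> a) by move=> c _ k; exact: Ck_on_cst.
have sM (f g : M -> R) : smooth f -> smooth g -> smooth (f * g).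
  move=> sf sg c ac k.
  have := Ck_onM (@cimg_open _ _ _ c) (sf c ac k) (sg c ac k); exact.
split; first by apply/S; exact: scst.
- move=> f g /S sf /S sg; apply/S.
  rewrite (_ : f - g = f + (fun=> -1) * g); last first.
    by apply/funext => x /=; rewrite [RHS]/GRing.add/= /GRing.mul/= mulN1r.
  move=> c ac k.
  have := Ck_onD (@cimg_open _ _ _ c) (sf c ac k) (sM _ _ (scst (-1)) sg c ac k).
  exact.
- by move=> f g /S sf /S sg; apply/S; exact: sM.
Qed.

HB.instance Definition _ :=
  GRing.isSubringClosed.Build (M -> R) smooth_pred smooth_subring_closed.
HB.instance Definition _ := GRing.SubChoice_isSubComPzRing.Build (M -> R)
  smooth_pred smooth_fun smooth_subring_closed.

Lemma smooth_funP (f g : smooth_fun) : f =1 g -> f = g.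
Proof. by move=> fg; apply/val_inj/funext. Qed.

Lemma smooth_fun_smooth (f : smooth_fun) : smooth f.
Proof. exact: (asboolW (smooth_valP f)). Qed.

Fact smooth_fun_oner_neq0 : (1 : smooth_fun) != 0.
Proof.
have [p _] := manifold_nonempty M.
apply/eqP => /(congr1 (fun f : smooth_fun => f p)) /eqP.
by rewrite (oner_eq0 R).
Qed.

HB.instance Definition _ :=
  GRing.PzSemiRing_isNonZero.Build smooth_fun smooth_fun_oner_neq0.

Fact smooth_cst_subproof (a : R) : (fun=> a) \in smooth_pred.
Proof. by apply: asboolT => c _ k; exact: Ck_on_cst. Qed.

Definition smooth_cst (a : R) : smooth_fun := SmoothFun (smooth_cst_subproof a).

Definition smooth_scale (a : R) (f : smooth_fun) : smooth_fun :=
  smooth_cst a * f.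

Fact smooth_scaleA a b f :
  smooth_scale a (smooth_scale b f) = smooth_scale (a * b) f.
Proof. by apply: smooth_funP => p; exact: mulrA. Qed.
Fact smooth_scale1 : left_id 1 smooth_scale.
Proof. by move=> f; apply: smooth_funP => p; exact: mul1r. Qed.
Fact smooth_scaleDr : right_distributive smooth_scale +%R.
Proof. by move=> a f g; exact: mulrDr. Qed.
Fact smooth_scaleDl f : {morph smooth_scale^~ f : a b / a + b}.
Proof. by move=> a b; apply: smooth_funP => p; exact: mulrDl. Qed.

HB.instance Definition _ := GRing.Zmodule_isLmodule.Build R smooth_fun
  smooth_scaleA smooth_scale1 smooth_scaleDr smooth_scaleDl.

Fact smooth_scaleAl (a : R) (f g : smooth_fun) : a *: (f * g) = a *: f * g.
Proof. exact: mulrA. Qed.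

HB.instance Definition _ :=
  GRing.Lmodule_isLalgebra.Build R smooth_fun smooth_scaleAl.
HB.instance Definition _ := GRing.Lalgebra_isComAlgebra.Build R smooth_fun.

(* Vector fields are the derivations of the R-algebra of smooth functions;
   the value of X at p is the derivation at p sending f to X f p. *)
Record vector_field := VectorField {
  vf_fun :> smooth_fun -> smooth_fun;
  vf_linear : linear vf_fun;
  vf_leibniz : forall f g, vf_fun (f * g) = f * vf_fun g + g * vf_fun f }.

Lemma vector_fieldP (X Y : vector_field) : X =1 Y -> X = Y.
Proof.
case: X Y => [X lX dX] [Y lY dY] /= /funext XY; subst Y.
by congr VectorField; exact: Prop_irrelevance.
Qed.

HB.instance Definition _ := gen_eqMixin vector_field.
HB.instance Definition _ := gen_choiceMixin vector_field.

Fact vf0_linear : linear (fun _ : smooth_fun => 0 : smooth_fun).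
Proof. by move=> a f g; rewrite scaler0 addr0. Qed.
Fact vf0_leibniz (f g : smooth_fun) : 0 = f * 0 + g * 0.
Proof. by rewrite !mulr0 addr0. Qed.
Definition vf0 := VectorField vf0_linear vf0_leibniz.

Fact vfD_linear (X Y : vector_field) : linear (fun f : smooth_fun => X f + Y f).
Proof. by move=> a f g; rewrite !vf_linear scalerDr addrACA. Qed.
Fact vfD_leibniz (X Y : vector_field) (f g : smooth_fun) :
  X (f * g) + Y (f * g) = f * (X g + Y g) + g * (X f + Y f).
Proof. by rewrite !vf_leibniz !mulrDr addrACA. Qed.
Definition vfD X Y := VectorField (vfD_linear X Y) (@vfD_leibniz X Y).

Fact vfZ_linear (h : smooth_fun) (X : vector_field) : linear (fun f : smooth_fun => h * X f).
Proof. by move=> a f g; rewrite vf_linear mulrDr scalerAr. Qed.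
Fact vfZ_leibniz (h : smooth_fun) (X : vector_field) (f g : smooth_fun) :
  h * X (f * g) = f * (h * X g) + g * (h * X f).
Proof. by rewrite vf_leibniz mulrDr mulrCA [h * (g * _)]mulrCA. Qed.
Definition vfZ h X := VectorField (vfZ_linear h X) (@vfZ_leibniz h X).

Fact vfDA : associative vfD.
Proof. by move=> X Y Z; apply: vector_fieldP => f; exact: addrA. Qed.
Fact vfDC : commutative vfD.
Proof. by move=> X Y; apply: vector_fieldP => f; exact: addrC. Qed.
Fact vfD0 : left_id vf0 vfD.
Proof. by move=> X; apply: vector_fieldP => f; exact: add0r. Qed.
Fact vfDN : left_inverse vf0 (vfZ (-1)) vfD.
Proof. by move=> X; apply: vector_fieldP => f /=; rewrite mulN1r addNr. Qed.

HB.instance Definition _ :=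
  GRing.isZmodule.Build vector_field vfDA vfDC vfD0 vfDN.

Fact vfZA h k X : vfZ h (vfZ k X) = vfZ (h * k) X.
Proof. by apply: vector_fieldP => f; exact: mulrA. Qed.
Fact vfZ1 : left_id 1 vfZ.
Proof. by move=> X; apply: vector_fieldP => f; exact: mul1r. Qed.
Fact vfZDr : right_distributive vfZ +%R.
Proof. by move=> h X Y; apply: vector_fieldP => f; exact: mulrDr. Qed.
Fact vfZDl X : {morph vfZ^~ X : h k / h + k}.
Proof. by move=> h k; apply: vector_fieldP => f; exact: mulrDl. Qed.

HB.instance Definition _ := GRing.Zmodule_isLmodule.Build smooth_fun vector_field
  vfZA vfZ1 vfZDr vfZDl.

Fact bracket_linear (X Y : vector_field) : linear (fun f : smooth_fun => X (Y f) - Y (X f)).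
Proof. by move=> a f g; rewrite !vf_linear scalerBr opprD addrACA. Qed.
Fact bracket_leibniz (X Y : vector_field) (f g : smooth_fun) :
  X (Y (f * g)) - Y (X (f * g)) =
  f * (X (Y g) - Y (X g)) + g * (X (Y f) - Y (X f)).
Proof.
have XD (Z : vector_field) (u v : smooth_fun) : Z (u + v) = Z u + Z v.
  by have := vf_linear Z 1 u v; rewrite !scale1r.
rewrite !vf_leibniz !XD !vf_leibniz.
ring.
Qed.
Definition bracket X Y :=
  VectorField (bracket_linear X Y) (@bracket_leibniz X Y).

Definition vf_vanishes (X : vector_field) (p : M) : Prop :=
  forall f : smooth_fun, X f p = 0.

End SmoothFunctions.

Section DifferentialForms.
Variables (R : realType) (m : nat) (M : manifold R m).
Local Notation C := (smooth_fun M).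
Local Notation X := (vector_field M).

(* The tensoriality and the alternation of a differential form are not
   recorded in the type. *)
Definition kform (k : nat) : Type := ('I_k -> X) -> C.

(* The normalizations of wedge and d go together (alternation is the averaged
   sum over permutations, whence the factor 1/2 in d). *)
Definition wedge k l (a : kform k) (b : kform l) : kform (k + l) :=
  fun Z => ((k + l)`!%:R^-1 : R) *:
    \sum_(s : 'S_(k + l)) (-1) ^+ s *
      (a (fun i => Z (s (lshift l i))) * b (fun j => Z (s (rshift k j)))).

Definition dform (eta : {scalar X}) (Y Z : X) : C :=
  (2^-1 : R) *: (Y (eta Z) - Z (eta Y) - eta (bracket Y Z)).

Definition kform1 (eta : {scalar X}) : kform 1 := fun Z => eta (Z ord0).

Definition kform_d (eta : {scalar X}) : kform 2 :=
  fun Z => dform eta (Z ord0) (Z ord_max).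

Fixpoint wedge_exp (a : kform 2) (n : nat) : kform (n * 2) :=
  if n is n'.+1 then wedge a (@wedge_exp a n') else fun=> 1.

Definition form_nonzero_at k (a : kform k) (p : M) : Prop :=
  exists Z : 'I_k -> X, a Z p != 0.

End DifferentialForms.

Arguments wedge_exp {R m M} a n.

Section Geometry.
Variables (R : realType) (m : nat) (M : manifold R m).
Local Notation C := (smooth_fun M).
Local Notation X := (vector_field M).
Implicit Types U V W Y Z : X.

Record riemannian_metric := RiemannianMetric {
  metric :> {biscalar X};
  metric_sym : forall Y Z, metric Y Z = metric Z Y;
  metric_ge0 : forall Y p, 0 <= metric Y Y p;
  metric_definite : forall Y p, metric Y Y p = 0 -> vf_vanishes Y p }.

Record connection := Connection {
  nabla :> X -> X -> X;
  nabla_linearl : forall Z, linear (nabla^~ Z);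
  nablaDr : forall Y, {morph nabla Y : U V / U + V};
  nabla_leibniz : forall Y (f : C) Z,
    nabla Y (f *: Z) = Y f *: Z + f *: nabla Y Z }.

Definition levi_civita (g : riemannian_metric) (D : connection) : Prop :=
  (forall Y Z, D Y Z - D Z Y = bracket Y Z) /\
  (forall U Y Z, U (g Y Z) = g (D U Y) Z + g Y (D U Z)).

Definition curvature (D : connection) Y Z V : X :=
  D Y (D Z V) - D Z (D Y V) - D (bracket Y Z) V.

Definition nabla_curvature (D : connection) W Y Z V : X :=
  D W (curvature D Y Z V) - curvature D (D W Y) Z V
  - curvature D Y (D W Z) V - curvature D Y Z (D W V).

Definition constant_curvature (g : riemannian_metric) (D : connection) : Prop :=
  exists lambda : R, forall Y Z V,
    curvature D Y Z V = lambda%:A *: (g Z V *: Y - g Y V *: Z).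

Definition phi_recurrent (phi : {linear X -> X}) (D : connection) : Prop :=
  exists2 A : {scalar X}, exists W, A W != 0 &
    forall W Y Z V,
      phi (phi (nabla_curvature D W Y Z V)) = A W *: curvature D Y Z V.

End Geometry.

Record contact_metric (R : realType) (n : nat) (M : manifold R (2 * n + 1)) :=
    ContactMetric {
  cm_eta : {scalar vector_field M};
  cm_xi : vector_field M;
  cm_metric : riemannian_metric M;
  cm_phi : {linear vector_field M -> vector_field M};
  cm_contact : forall p,
    form_nonzero_at (wedge (kform1 cm_eta) (wedge_exp (kform_d cm_eta) n)) p;
  cm_eta_xi : cm_eta cm_xi = 1;
  cm_deta_xi : forall Y, dform cm_eta cm_xi Y = 0;
  cm_metric_xi : forall Y, cm_eta Y = cm_metric Y cm_xi;
  cm_metric_phi : forall Y Z, dform cm_eta Y Z = cm_metric Y (cm_phi Z);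
  cm_phi2 : forall Y, cm_phi (cm_phi Y) = - Y + cm_eta Y *: cm_xi }.

(* Main.v *)
From mathcomp Require Import all_boot all_order all_algebra perm.
From mathcomp Require Import all_classical reals topology ring.
Require Import Defs.

(* Constant curvature makes R parallel, so phi-recurrence reads A(W) R = 0 and
   the curvature constant vanishes. The heart is Blair's theorem that a contact
   metric manifold of dimension at least 5 is not flat.
   Put B = nabla xi. Flatness gives B^2 = 0 and B phi + phi B = -2 phi^2, so the
   tangent bundle splits orthogonally into D+ = im(phi B) and ker B, and B/2 is
   an isometry of D+ into ker B. Both summands are parallel: ker B is
   autoparallel by Codazzi, and its splitting operators
   C_X U = (nabla_U X)^+ are skew on D+ and satisfy a Riccati equation which
   forces C_X = 0. Hence nabla_U (B V) = B (nabla_U V) - 4 g(U, V) xi on D+, and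
   R(U, V)(B W) = 0 becomes g(V, W) U = g(U, W) V: the rank of D+ is at most 1.
   Then d eta has rank at most 2 and (d eta)^2 = 0, contradicting contactness. *)

Set Implicit Arguments.
Unset Strict Implicit.
Unset Printing Implicit Defensive.
Import Order.TTheory GRing.Theory Num.Theory.

(** * Levi-Civita calculus, constant curvature and flatness *)

Section LeviCivita.
Local Open Scope ring_scope.
Variables (R : realType) (m : nat) (M : manifold R m).
Variables (g : riemannian_metric M) (D : connection M).
Implicit Types (T U V W Y Z : vector_field M) (f h : smooth_fun M).

Lemma smooth_double_eq0 f : f *+ 2 = 0 -> f = 0.
Proof.
move=> f2; have two_neq0 : (2 : R) != 0 by rewrite pnatr_eq0.
by rewrite -[f]scale1r -(mulVf two_neq0) -scalerA scaler_nat f2 scaler0.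
Qed.

(* Proof by linear combination: [f' = h'] is a combination of hypotheses, and
   the remaining identity is left to [ring]. *)
Lemma eq_of_subr_eq f h f' h' : f' = h' -> f - h = f' - h' -> f = h.
Proof. by move=> ->; rewrite subrr => /subr0_eq. Qed.

Lemma metricDl Z U V : g (U + V) Z = g U Z + g V Z.
Proof. by rewrite linearDl. Qed.
Lemma metricDr Z U V : g Z (U + V) = g Z U + g Z V.
Proof. by rewrite linearDr. Qed.
Lemma metricNl Z U : g (- U) Z = - g U Z.
Proof. by rewrite linearNl. Qed.
Lemma metricNr Z U : g Z (- U) = - g Z U.
Proof. by rewrite linearNr. Qed.
Lemma metricMnl Z U k : g (U *+ k) Z = g U Z *+ k.
Proof. by rewrite linearMnl. Qed.
Lemma metricMnr Z U k : g Z (U *+ k) = g Z U *+ k.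
Proof. by rewrite linearMnr. Qed.
Lemma metric0l Z : g 0 Z = 0.
Proof. by rewrite linear0l. Qed.
Lemma metric0r Z : g Z 0 = 0.
Proof. by rewrite linear0r. Qed.
Lemma metricZl f Z U : g (f *: U) Z = f * g U Z.
Proof. by rewrite linearZl_LR. Qed.
Lemma metricZr f Z U : g Z (f *: U) = f * g Z U.
Proof. by rewrite linearZ. Qed.

Definition metricE := (metricDl, metricDr, metricNl, metricNr, metricMnl,
  metricMnr, metric0l, metric0r, metricZl, metricZr).

Lemma metric_eq0 Y : g Y Y = 0 -> Y = 0.
Proof.
move=> gYY0; apply: vector_fieldP => f; apply: smooth_funP => p.
by apply: (metric_definite (r := g)); rewrite gYY0.
Qed.

Lemma metric_ext Y Z : (forall T, g Y T = g Z T) -> Y = Z.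
Proof.
move=> YZ; apply: subr0_eq; apply: metric_eq0.
by rewrite metricDl metricNl YZ subrr.
Qed.

Lemma vector_field_double_eq0 Y : Y *+ 2 = 0 -> Y = 0.
Proof.
move=> Y2; apply: metric_eq0; apply: smooth_double_eq0.
by rewrite -metricMnl Y2 metric0l.
Qed.

Lemma vector_fieldD Y f h : Y (f + h) = Y f + Y h.
Proof. by have := vf_linear Y 1 f h; rewrite !scale1r. Qed.
Lemma vector_field0 Y : Y 0 = 0.
Proof. by apply: (addrI (Y 0)); rewrite -vector_fieldD !addr0. Qed.
Lemma vector_fieldMn Y f k : Y (f *+ k) = Y f *+ k.
Proof.
elim: k => [|k IH]; rewrite ?mulr0n ?vector_field0 //.
by rewrite !mulrS vector_fieldD IH.
Qed.
Lemma vector_field1 Y : Y 1 = 0.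
Proof.
have /eqP := vf_leibniz Y 1 1; rewrite !mul1r -subr_eq0 opprD addNKr oppr_eq0.
by move/eqP.
Qed.
Lemma vector_field_alg Y (a : R) : Y a%:A = 0.
Proof.
have := vf_linear Y a 1 0.
by rewrite addr0 vector_field0 vector_field1 scaler0 addr0.
Qed.

Lemma nablaDl Z U V : D (U + V) Z = D U Z + D V Z.
Proof. by have := nabla_linearl D Z 1 U V; rewrite !scale1r. Qed.
Lemma nabla0l Z : D 0 Z = 0.
Proof. by apply: (addrI (D 0 Z)); rewrite -nablaDl !addr0. Qed.
Lemma nablaZl f Z U : D (f *: U) Z = f *: D U Z.
Proof. by have := nabla_linearl D Z f U 0; rewrite !addr0 nabla0l addr0. Qed.
Lemma nablaNl Z U : D (- U) Z = - D U Z.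
Proof. by rewrite -scaleN1r nablaZl scaleN1r. Qed.
Lemma nablaMnl Z U k : D (U *+ k) Z = D U Z *+ k.
Proof. by rewrite -scaler_nat nablaZl scaler_nat. Qed.
Lemma nabla0r Z : D Z 0 = 0.
Proof. by apply: (addrI (D Z 0)); rewrite -nablaDr !addr0. Qed.
Lemma nablaNr Z U : D Z (- U) = - D Z U.
Proof. by apply/eqP; rewrite -addr_eq0 -nablaDr addNr nabla0r. Qed.
Lemma nablaMnr Z U k : D Z (U *+ k) = D Z U *+ k.
Proof.
by elim: k => [|k IH]; rewrite ?mulr0n ?nabla0r // !mulrS nablaDr IH.
Qed.

Definition nablaE := (nablaDl, nablaNl, nablaMnl, nablaZl, nabla0l,
  nablaDr D, nablaNr, nablaMnr, nabla_leibniz, nabla0r).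

Hypothesis D_LC : levi_civita g D.

Lemma nabla_torsion Y Z : bracket Y Z = D Y Z - D Z Y.
Proof. by case: D_LC => ->. Qed.

Lemma nabla_metric U Y Z : U (g Y Z) = g (D U Y) Z + g Y (D U Z).
Proof. by case: D_LC => _ ->. Qed.

(** The curvature is a constant multiple of a tensor built from [g], and [g] is parallel. *)
Lemma constant_curvature_parallel : constant_curvature g D ->
  forall W Y Z V, nabla_curvature D W Y Z V = 0.
Proof.
case=> lambda Rg W Y Z V; rewrite /nabla_curvature !Rg.
rewrite nabla_leibniz vector_field_alg scale0r add0r.
rewrite nablaDr nablaNr !nabla_leibniz !nabla_metric.
apply: metric_ext => T; rewrite !metricE.
ring.
Qed.

Lemma flat_nabla_comm : (forall Y Z V, curvature D Y Z V = 0) ->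
  forall Y Z V, D Y (D Z V) = D Z (D Y V) + D (D Y Z) V - D (D Z Y) V.
Proof.
move=> flat Y Z V; have /subr0_eq := flat Y Z V.
rewrite nabla_torsion !nablaE => /eqP; rewrite subr_eq => /eqP ->.
by rewrite addrC addrA.
Qed.

End LeviCivita.

(** * The operator [B = nabla xi] and its algebra under flatness *)

Section FlatContact.
Local Open Scope ring_scope.
Variables (R : realType) (n : nat) (M : manifold R (2 * n + 1)).
Variables (S : contact_metric M) (D : connection M).
Implicit Types (N T U V W X Y Z : vector_field M) (f h : smooth_fun M).
Local Notation g := (cm_metric S).
Local Notation phi := (cm_phi S).
Local Notation xi := (cm_xi S).
Local Notation B Y := (D Y xi).

Lemma reeb_unit : g xi xi = 1.
Proof. by rewrite -cm_metric_xi cm_eta_xi. Qed.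

Lemma phiD Y Z : phi (Y + Z) = phi Y + phi Z.
Proof. exact: raddfD. Qed.
Lemma phiN Y : phi (- Y) = - phi Y.
Proof. exact: raddfN. Qed.
Lemma phiMn Y k : phi (Y *+ k) = phi Y *+ k.
Proof. exact: raddfMn. Qed.
Lemma phiZ f Y : phi (f *: Y) = f *: phi Y.
Proof. exact: linearZ. Qed.
Lemma phi0 : phi 0 = 0.
Proof. exact: raddf0. Qed.
Definition phiE := (phiD, phiN, phiMn, phiZ, phi0).

Lemma phi_sqr Y : phi (phi Y) = - Y + g Y xi *: xi.
Proof. by rewrite cm_phi2 cm_metric_xi. Qed.

Hypothesis D_LC : levi_civita g D.

Lemma metric_phi_double Y Z : g Y (phi Z) *+ 2 = g Z (B Y) - g Y (B Z).
Proof.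
rewrite -cm_metric_phi /dform !cm_metric_xi !(nabla_metric D_LC).
rewrite (nabla_torsion D_LC) -scaler_nat scalerA mulfV ?pnatr_eq0// scale1r.
rewrite !metricE.
ring.
Qed.

(** The adjoint of [B] is [B + 2 phi], since [d eta] measures the skew part of [nabla xi]. *)
Lemma metric_reeb_shape Y Z : g (B Y) Z = g Y (B Z) + g Y (phi Z) *+ 2.
Proof. by rewrite metric_phi_double addrC subrK metric_sym. Qed.

Lemma phi_skew Y Z : g (phi Y) Z = - g Y (phi Z).
Proof.
apply/eqP; rewrite -subr_eq0 opprK; apply/eqP; apply: smooth_double_eq0.
rewrite mulrnDl metric_phi_double (metric_sym g (phi Y)) metric_phi_double.
ring.
Qed.

Lemma phi_orth_reeb Y : g xi (phi Y) = 0.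
Proof. by rewrite -cm_metric_phi cm_deta_xi. Qed.

Lemma reeb_shape_orth_reeb Y : g xi (B Y) = 0.
Proof.
apply: smooth_double_eq0; have := nabla_metric D_LC Y xi xi.
by rewrite reeb_unit vector_field1 (metric_sym g (B Y)) => ->; rewrite mulr2n.
Qed.

Lemma reeb_geodesic : B xi = 0.
Proof.
apply: (@metric_ext _ _ _ g) => T; rewrite metric_reeb_shape.
by rewrite reeb_shape_orth_reeb phi_orth_reeb mul0rn addr0 metric0l.
Qed.

Hypothesis flat : forall Y Z V, curvature D Y Z V = 0.
Let comm := flat_nabla_comm D_LC flat.

(** Riccati equation [nabla_xi B = - B^2], from [R(xi, Y) xi = 0] and [xi] geodesic. *)
Lemma nabla_reeb_shape Y : D xi (B Y) = B (D xi Y) - B (B Y).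
Proof. by rewrite comm reeb_geodesic nabla0r add0r. Qed.

Lemma phi2_B Y : phi (phi (B Y)) = - B Y.
Proof. by rewrite phi_sqr metric_sym reeb_shape_orth_reeb scale0r addr0. Qed.

Lemma B_phi2 Y : B (phi (phi Y)) = - B Y.
Proof. by rewrite phi_sqr !nablaE reeb_geodesic scaler0 addr0. Qed.

(** Obtained by differentiating the adjoint relation for [B] along [xi], with the Riccati
    equation. *)
Lemma nabla_reeb_phi Y : D xi (phi Y) =
  phi (D xi Y) - (B (phi Y) + phi (B Y) + phi (phi Y) *+ 2).
Proof.
apply: (@metric_ext _ _ _ g) => Z; rewrite -!(metric_sym g Z).
have adj U V := metric_reeb_shape U V.
have := congr1 (xi : _ -> _) (adj Z Y).
rewrite vector_fieldD vector_fieldMn !(nabla_metric D_LC) !nabla_reeb_shape.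
rewrite !metricE adj (adj (B Z)) (adj Z) (adj Z (phi Y)) (adj Z (D xi Y)) => H.
apply: subr0_eq; apply: smooth_double_eq0.
apply: (eq_of_subr_eq (esym H)).
ring.
Qed.

(** Here [J = - nabla_xi phi]. As [phi^2] is parallel along the geodesic field [xi],
    [phi J + J phi = 0], which expands to [phi B phi = B + 2 phi]; composing with [phi] gives the
    claim. *)
Lemma B_phi_anticomm Y : B (phi Y) + phi (B Y) = phi (phi Y) *- 2.
Proof.
pose J Z := B (phi Z) + phi (B Z) + phi (phi Z) *+ 2.
have Dphi Z : D xi (phi Z) = phi (D xi Z) - J Z by exact: nabla_reeb_phi.
have JphiJ : phi (J Y) + J (phi Y) = 0.
  have : D xi (phi (phi Y)) = phi (phi (D xi Y)).
    rewrite !phi_sqr nablaDr nablaNr nabla_leibniz (nabla_metric D_LC).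
    by rewrite reeb_geodesic metric0r addr0 scaler0 addr0.
  rewrite !Dphi !phiE -addrA => /(canRL (addKr _)).
  by rewrite addNr -opprD => /eqP; rewrite oppr_eq0 => /eqP.
have phi3 Z : phi (phi (phi Z)) = - phi Z.
  by rewrite phi_sqr metric_sym phi_orth_reeb scale0r addr0.
have : (phi (B (phi Y)) - B Y - phi Y *+ 2) *+ 2 = 0.
  rewrite -JphiJ /J !phiE phi3 phi2_B B_phi2.
  by apply: (@metric_ext _ _ _ g) => T; rewrite !metricE; ring.
move/(@vector_field_double_eq0 _ _ _ g)/eqP.
rewrite subr_eq0 subr_eq => /eqP /(congr1 phi).
rewrite phi2_B !phiE => /eqP.
rewrite eqr_oppLR opprD => /eqP ->.
by apply: (@metric_ext _ _ _ g) => T; rewrite !metricE; ring.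
Qed.

(** By anticommutation [phi] commutes with [B^2], and [nabla_xi phi = 0]. Differentiating the
    anticommutation relation along [xi] then gives [2 phi B^2 = 0], and [phi] is injective
    orthogonally to [xi]. *)
Lemma B_sqr Y : B (B Y) = 0.
Proof.
have eq0 : phi (B (B Y)) = B (B (phi Y)).
  have /(canRL (addrK _)) -> := B_phi_anticomm Y.
  rewrite nablaDl !nablaNl nablaMnl B_phi2.
  have /(canRL (addrK _)) -> := B_phi_anticomm (B Y).
  rewrite phi2_B; apply: (@metric_ext _ _ _ g) => T; rewrite !metricE; ring.
have Dphi Z : D xi (phi Z) = phi (D xi Z).
  by rewrite nabla_reeb_phi B_phi_anticomm addNr subr0.
have : D xi (B (phi Y) + phi (B Y)) = D xi (phi (phi Y) *- 2).
  by rewrite B_phi_anticomm.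
rewrite nablaNr nablaMnr nablaDr nabla_reeb_shape !Dphi -B_phi_anticomm.
rewrite nabla_reeb_shape !phiE addrACA -eq0 -opprD -mulr2n.
move=> /(canRL (addKr _)); rewrite addNr => /eqP; rewrite oppr_eq0 => /eqP.
move/(@vector_field_double_eq0 _ _ _ g) => phiBB0.
by apply: oppr_inj; rewrite -phi2_B phiBB0 phi0 oppr0.
Qed.

(** So [phi B / 2] is idempotent, with the same kernel as [B]. *)
Lemma BphiB Y : B (phi (B Y)) = B Y *+ 2.
Proof.
have /(canRL (addrK _)) -> := B_phi_anticomm (B Y).
by rewrite B_sqr phi2_B phi0 subr0 mulNrn opprK.
Qed.

(** As the left-hand side is symmetric, [phi B] is self-adjoint. *)
Lemma metric_BB Y Z : g (B Y) (B Z) = g Y (phi (B Z)) *+ 2.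
Proof. by rewrite metric_reeb_shape B_sqr metric0r add0r. Qed.

(** * The orthogonal splitting into D+ and [ker B] *)

Local Notation ker X := (B X = 0).
(* [phi B / 2] is the orthogonal projection onto the bundle D+. *)
Local Notation pos U := (phi (B U) = U *+ 2).

Lemma pos_phiB Y : pos (phi (B Y)).
Proof. by rewrite BphiB phiMn. Qed.

Lemma ker_comp Y : ker (Y *+ 2 - phi (B Y)).
Proof. by rewrite nablaDl nablaNl BphiB nablaMnl subrr. Qed.

Lemma pos_metric_BB Y U : pos U -> g (B Y) (B U) = g Y U *+ 4.
Proof. by move=> pU; rewrite metric_BB pU metricMnr -mulrnA. Qed.

Lemma ker_orth_pos U X : pos U -> ker X -> g X U = 0.
Proof.
move=> pU kX; apply: smooth_double_eq0; apply: smooth_double_eq0.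
by rewrite -mulrnA -pos_metric_BB // kX metric0l.
Qed.

Lemma pos_of_orth_ker U : (forall X, ker X -> g X U = 0) -> pos U.
Proof.
move=> oU; have kX := ker_comp U; set X := U *+ 2 - _ in kX.
suff : X = 0 by move/subr0_eq.
apply: (@metric_eq0 _ _ _ g).
rewrite {2}/X metricDr metricNr metricMnr (oU _ kX) mul0rn add0r.
by rewrite (ker_orth_pos (pos_phiB U) kX) oppr0.
Qed.

(** Hence [ker B] is the image of [B] plus the line of [xi]. *)
Lemma ker_double X : ker X -> X *+ 2 = B (phi X) + (g X xi *+ 2) *: xi.
Proof.
move=> kX; have := B_phi_anticomm X; rewrite kX phi0 addr0 => ->.
by rewrite phi_sqr; apply: (@metric_ext _ _ _ g) => T; rewrite !metricE; ring.
Qed.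

(** * Parallelism of the two summands *)

Lemma ker_nabla_B X Y : ker X -> D X (B Y) = B (D X Y) - B (D Y X).
Proof. by move=> kX; rewrite comm kX nabla0r add0r. Qed.

(** With [X] written as in [ker_double], Codazzi puts the derivative of [B (phi X)] in the image of
    [B], which [B] kills, and [nabla_N xi = 0]. *)
Lemma ker_nabla_ker N X : ker N -> ker X -> ker (D N X).
Proof.
move=> kN kX; apply: (@vector_field_double_eq0 _ _ _ g).
rewrite -nablaMnl -nablaMnr (ker_double kX) nablaDr ker_nabla_B //.
rewrite nabla_leibniz kN scaler0 addr0 !nablaE reeb_geodesic !B_sqr.
by rewrite scaler0 subrr addr0.
Qed.

Lemma ker_nabla_pos X U : ker X -> pos U -> pos (D X U).
Proof.
move=> kX pU; apply: pos_of_orth_ker => N kN.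
have := nabla_metric D_LC X N U.
by rewrite !(ker_orth_pos pU) ?vector_field0 ?add0r//; exact: ker_nabla_ker.
Qed.

(* Differentiate [g (B U) (B V) = 4 g U V] along [X]. *)
Lemma splitting_skew X U V : ker X -> pos U -> pos V ->
  g (D U X) V + g (D V X) U = 0.
Proof.
move=> kX pU pV; have := congr1 (X : _ -> _) (pos_metric_BB U pV).
rewrite vector_fieldMn !(nabla_metric D_LC) !ker_nabla_B // !metricE.
rewrite ![g (B U) _]metric_sym !(pos_metric_BB _ pU) !(pos_metric_BB _ pV).
rewrite (metric_sym g U) => H.
do 2! apply: smooth_double_eq0; apply: (eq_of_subr_eq (esym H)); ring.
Qed.

(** With [C] the splitting operator of [X], skewness gives [|C U|^2 = - g (C (C U)) U]; the Riccati
    equation from [R(X, U) X = 0], paired with [U], makes the right-hand side vanish. *)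
Lemma ker_nabla_by_pos X U : ker X -> pos U -> ker (D U X).
Proof.
move=> kX pU; set W := D U X.
apply: (@metric_eq0 _ _ _ g); rewrite metric_BB.
have skewU N : ker N -> g (D U N) U = 0.
  by move=> kN; apply: smooth_double_eq0; rewrite mulr2n splitting_skew.
set V := phi (B W); have pV : pos V by exact: pos_phiB.
have kN := ker_comp W; rewrite -/V in kN.
(* The [ker B] part of [2 W] contributes nothing, as [ker B] is autoparallel; so [V] may be replaced
   by [2 W]. *)
have VE : V = W *+ 2 - (W *+ 2 - V) by rewrite opprB addrC subrK.
have -> : g W V = - g (D V X) U by apply/eqP; rewrite -addr_eq0 splitting_skew.
rewrite VE nablaDl nablaNl metricDl metricNl.
rewrite (ker_orth_pos pU (ker_nabla_ker kN kX)) subr0 nablaMnl metricMnl.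
suff -> : g (D W X) U = 0 by rewrite mul0rn oppr0 mul0rn.
have kDX := ker_nabla_ker kX kX.
have pDU := ker_nabla_pos kX pU.
have := congr1 (fun Z => g Z U) (comm X U X).
rewrite -/W !metricE (skewU _ kDX) add0r.
have := nabla_metric D_LC X W U; rewrite (skewU _ kX) vector_field0.
have := splitting_skew kX pU pDU; rewrite -/W.
move=> h1 h2 h3.
apply: (eq_of_subr_eq (congr2 +%R h3 (congr2 +%R h2 h1))); ring.
Qed.

Lemma ker_parallel X Y : ker X -> ker (D Y X).
Proof.
move=> kX; apply: (@vector_field_double_eq0 _ _ _ g).
have [N kN YE] : exists2 N, ker N & Y *+ 2 = phi (B Y) + N.
  by exists (Y *+ 2 - phi (B Y)); [exact: ker_comp | rewrite addrC subrK].
rewrite -!nablaMnl YE !nablaDl (ker_nabla_by_pos kX (pos_phiB Y)) add0r.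
exact: ker_nabla_ker.
Qed.

Lemma pos_parallel U Y : pos U -> pos (D Y U).
Proof.
move=> pU; apply: pos_of_orth_ker => N kN.
have := nabla_metric D_LC Y N U.
by rewrite !(ker_orth_pos pU) ?vector_field0 ?add0r//; exact: ker_parallel.
Qed.

(** * The derivative of [B] on D+ and the rank of [d eta] *)

Lemma nabla_B_pos U V : pos U -> pos V ->
  D U (B V) = B (D U V) - (g U V *+ 4) *: xi.
Proof.
move=> pU pV.
(* [T] is [nabla B]: symmetric by Codazzi, while [g (T Y Z) (B N)] is skew in [Z] and [N] because
   [B / 2] is isometric on D+. *)
pose T Y Z := D Y (B Z) - B (D Y Z).
have Tsym Y Z : T Y Z = T Z Y.
  by rewrite /T comm; apply: (@metric_ext _ _ _ g) => N; rewrite !metricE; ring.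
have Tskew Y Z N : pos Z -> pos N -> g (T Y Z) (B N) = - g (T Y N) (B Z).
  move=> pZ pN; have := congr1 (Y : _ -> _) (pos_metric_BB Z pN).
  rewrite vector_fieldMn !(nabla_metric D_LC) /T !metricE.
  rewrite (metric_sym g Z) (metric_sym g (B Z)).
  rewrite !(pos_metric_BB _ pN) !(pos_metric_BB _ pZ) => H.
  apply: (eq_of_subr_eq H); ring.
(* A trilinear form symmetric in its first two arguments and skew in its last two is zero. *)
have TB Z : pos Z -> g (T U V) (B Z) = 0.
  move=> pZ; apply: smooth_double_eq0.
  rewrite mulr2n {1}Tskew // Tsym.
  rewrite Tskew // (Tsym Z V) Tskew // opprK (Tsym V U) Tskew //.
  by rewrite (Tsym U) addNr.
have kT : ker (T U V).
  by rewrite /T nablaDl nablaNl ker_parallel ?B_sqr ?subrr.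
have Txi : g (T U V) xi = g U V *- 4.
  have := nabla_metric D_LC U (B V) xi.
  rewrite metric_sym reeb_shape_orth_reeb vector_field0 (pos_metric_BB _ pU).
  rewrite /T metricDl metricNl (metric_sym g (B (D U V))) reeb_shape_orth_reeb.
  by rewrite subr0 (metric_sym g V) => /esym/eqP; rewrite addr_eq0 => /eqP.
(* By [BphiB], twice [B (phi (T U V))] is [B] of a field in D+, so [TB] applies. *)
have Tphi : g (T U V) (B (phi (T U V))) = 0.
  by apply: smooth_double_eq0; rewrite -metricMnr -BphiB TB //; exact: pos_phiB.
suff : T U V + (g U V *+ 4) *: xi = 0.
  by rewrite /T -addrA => /(canRL (addrK _)); rewrite add0r opprD opprK.
apply: (@vector_field_double_eq0 _ _ _ g); apply: (@metric_eq0 _ _ _ g).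
have TE : (T U V + (g U V *+ 4) *: xi) *+ 2 = B (phi (T U V)).
  rewrite mulrnDl (ker_double kT) Txi.
  by apply: (@metric_ext _ _ _ g) => N; rewrite !metricE; ring.
rewrite {2}TE metricMnl metricDl Tphi metricZl reeb_shape_orth_reeb.
by rewrite mulr0 addr0 mul0rn.
Qed.

(** Up to a multiple of [xi], [R(U, V) (B W)] is [B (R(U, V) W) - 4 g(V, W) B U + 4 g(U, W) B V].
    Pairing with [B Y] gives 16 times the identity, hence the four halvings. *)
Lemma pos_rank_le1 U V W Y : pos U -> pos V -> pos W -> pos Y ->
  g V W * g U Y = g U W * g V Y.
Proof.
move=> pU pV pW pY.
have H1 := congr1 (fun Z => g Z (B Y)) (comm U V (B W)).
have H2 := congr1 (fun Z => g Z Y) (comm U V W).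
have pD := pos_parallel _ pW.
move: H1; rewrite !nabla_B_pos //; try exact: pos_parallel.
rewrite !nablaDr !nablaNr !nabla_leibniz !nabla_B_pos //.
rewrite !metricE !reeb_shape_orth_reeb !(pos_metric_BB _ pY) => H1.
move: H2; rewrite !metricE => H2.
apply: subr0_eq; do 4! apply: smooth_double_eq0.
apply: (eq_of_subr_eq (congr2 (fun a b => a + b *+ 4) (esym H1) H2)); ring.
Qed.

(** Splitting [Y] along D+, the image of [B] and [xi] leaves two terms of [g Y (phi Z)]; skewness of
    [phi] moves the second, [g (B (phi Y)) (phi Z)], back to D+. *)
Lemma dform_eta_pos Y Z : dform (cm_eta S) Y Z *+ 4 =
  g (phi (B Y)) (phi (B (phi Z))) - g (phi (B Z)) (phi (B (phi Y))).
Proof.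
rewrite cm_metric_phi.
have decomp X : X *+ 2 = phi (B X) + B (phi X) + (g X xi *+ 2) *: xi.
  rewrite [phi _ + _]addrC B_phi_anticomm phi_sqr.
  by apply: (@metric_ext _ _ _ g) => T; rewrite !metricE; ring.
have orth U X : g (phi (B U)) (B X) = 0.
  by rewrite metric_sym (ker_orth_pos (pos_phiB U)) // B_sqr.
have h1 := congr1 (g^~ (phi Z)) (decomp Y).
have h2 := congr1 (g (phi (B Y))) (decomp (phi Z)).
have h3 := congr1 (g (phi (B (phi Y)))) (decomp Z).
have h4 : g (B (phi Y)) (phi Z) = - g (phi (B (phi Y))) Z.
  by rewrite phi_skew opprK.
have xipos U : g (phi U) xi = 0 by rewrite metric_sym phi_orth_reeb.
move: h1 h2 h3; rewrite !metricE !orth ?xipos !phi_orth_reeb h4.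
rewrite [g (phi (B Z)) _]metric_sym => h1 h2 h3.
apply: (eq_of_subr_eq (congr2 +%R (congr1 (fun a => a *+ 2) h1)
  (congr2 (fun a b => a - b) h2 h3))); ring.
Qed.

(** [beta] pairs two vectors of D+, whose rank is at most 1, so at each point it is a product of two
    linear forms. *)
Lemma flat_dform_rank1 :
  exists beta : vector_field M -> vector_field M -> smooth_fun M,
  (forall Y Z, dform (cm_eta S) Y Z *+ 4 = beta Y Z - beta Z Y) /\
  (forall Y Z V W, beta Y Z * beta V W = beta V Z * beta Y W).
Proof.
exists (fun Y Z => g (phi (B Y)) (phi (B (phi Z)))); split=> [|Y Z V W].
  exact: dform_eta_pos.
by apply: pos_rank_le1; exact: pos_phiB.
Qed.

End FlatContact.

(** * Exterior powers of a 2-form that alternates a rank-one bilinear form *)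

Section Wedge.
Local Open Scope ring_scope.
Variables (R : realType) (m : nat) (M : manifold R m).

Lemma alternating_sum0 k (F : 'S_k -> R) (i j : 'I_k) : i != j ->
  (forall s, F (tperm i j * s)%g = F s) -> \sum_(s : 'S_k) (-1) ^+ s * F s = 0.
Proof.
move=> ij Fij; set s0 := \sum_(s : 'S_k) _.
have : s0 = - s0.
  rewrite {1}/s0 (reindex_inj (mulgI (tperm i j))) /= -sumrN.
  apply: eq_bigr => s _; rewrite Fij odd_permM odd_tperm ij /=.
  by case: (odd_perm s); rewrite /= ?mulN1r ?mul1r ?opprK.
move/eqP; rewrite -addr_eq0 -mulr2n mulrn_eq0 /= => /eqP; exact.
Qed.


Lemma wedge_at k l (a : kform M k) (b : kform M l)
    (Z : 'I_(k + l) -> vector_field M) p :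
  wedge a b Z p = ((k + l)`!%:R^-1 : R) * \sum_(s : 'S_(k + l)) (-1) ^+ s *
    (a (fun i => Z (s (lshift l i))) p * b (fun j => Z (s (rshift k j))) p).
Proof.
rewrite /wedge; set F := BIG_F.
rewrite (_ : forall (c : R) f, (c *: f : smooth_fun M) p = c * f p) //.
congr (_ * _).
rewrite (big_morph (fun f : smooth_fun M => f p) (id1 := 0) (op1 := +%R)) //.
by apply: eq_bigr => s _; rewrite /F; case: (odd_perm s).
Qed.

Lemma wedge_right_eq0 k l (a : kform M k) (b : kform M l) (p : M) :
  (forall Z, b Z p = 0) -> forall Z, wedge a b Z p = 0.
Proof.
move=> b0 Z; rewrite wedge_at big1 ?mulr0// => s _.
by rewrite b0 !mulr0.
Qed.

Section Rank1.
Variables (p : M) (beta : vector_field M -> vector_field M -> R).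
Hypothesis beta_rank1 :
  forall Y Z V W, beta Y Z * beta V W = beta V Z * beta Y W.

(** By the rank-one identity, exchanging the first arguments of the two [beta] factors fixes the
    product but flips the sign of [s]. *)
Lemma alternating_rank1 k (Z : 'I_k -> vector_field M) (w : 'S_k -> R)
    (i j i' j' : 'I_k) :
  i != i' -> j \notin [:: i; i'] -> j' \notin [:: i; i'] ->
  (forall s, w (tperm i i' * s)%g = w s) ->
  \sum_(s : 'S_k) (-1) ^+ s *
    (beta (Z (s i)) (Z (s j)) * beta (Z (s i')) (Z (s j')) * w s) = 0.
Proof.
rewrite !inE !negb_or => ii' /andP[ji ji'] /andP[j'i j'i'] ws.
apply: (alternating_sum0 ii') => s; rewrite ws !permM tpermL tpermR.
by rewrite !tpermD 1?eq_sym // beta_rank1.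
Qed.

(** Sixteen times a product of two values of [a] expands into four products of values of [beta]; for
    each inner permutation [t], the sum over the outer [s] kills every one. *)
Lemma wedge_rank1 l (a : kform M 2) (w : kform M l) :
  (forall Z, a Z p *+ 4 =
     beta (Z ord0) (Z ord_max) - beta (Z ord_max) (Z ord0)) ->
  forall Z, wedge a (wedge a w) Z p = 0.
Proof.
move=> aE Z.
(* [lo], [mid t] and [hi t] are the slots of the first [a], the second [a] and [w]. *)
pose lo (i : 'I_2) : 'I_(2 + (2 + l)) := lshift (2 + l) i.
pose mid (t : 'S_(2 + l)) (i : 'I_2) : 'I_(2 + (2 + l)) :=
  rshift 2 (t (lshift l i)).
pose hi (t : 'S_(2 + l)) (i : 'I_l) : 'I_(2 + (2 + l)) :=
  rshift 2 (t (rshift 2 i)).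
pose A s := a (fun i => Z (s (lo i))) p.
pose A' t s := a (fun i => Z (s (mid t i))) p.
pose W t (s : 'S_(2 + (2 + l))) := w (fun i => Z (s (hi t i))) p.
suff main t : \sum_(s : 'S_(2 + (2 + l))) (-1) ^+ s *
    (A s * A' t s * W t s) = 0.
  rewrite wedge_at.
  have E (s : 'S_(2 + (2 + l))) :
      (-1) ^+ s * (A s * wedge a w (fun i => Z (s (rshift 2 i))) p) =
      ((2 + l)`!%:R^-1 : R) * \sum_(t : 'S_(2 + l))
        (-1) ^+ t * ((-1) ^+ s * (A s * A' t s * W t s)).
    rewrite wedge_at [A s * _]mulrCA [LHS]mulrCA; congr (_ * _).
    rewrite !mulr_sumr.
    apply: eq_bigr => t _; rewrite -/(A' t s) -/(W t s).
    by move: (A s) (A' t s) (W t s) (_ ^+ s : R) (_ ^+ t : R) => *; ring.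
  rewrite (eq_bigr _ (fun s _ => E s)) -mulr_sumr exchange_big /=.
  rewrite big1 ?mulr0 //.
  by move=> t _; rewrite -mulr_sumr main mulr0.
have lo_mid i j : lo i != mid t j by rewrite eq_sym eq_rlshift.
have hi_lo i j : hi t i != lo j by rewrite eq_rlshift.
have hi_mid i j : hi t i != mid t j.
  by rewrite eq_rshift (inj_eq perm_inj) eq_rlshift.
have Winv i j s : W t (tperm (lo i) (mid t j) * s)%g = W t s.
  by congr (w _ p); apply/funext => k; rewrite permM tpermD // eq_sym.
pose T i j i' j' := \sum_(s : 'S_(2 + (2 + l))) (-1) ^+ s *
  (beta (Z (s (lo i))) (Z (s (lo j))) *
   beta (Z (s (mid t i'))) (Z (s (mid t j'))) * W t s).
have T0 i j i' j' : i != j -> i' != j' -> T i j i' j' = 0.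
  move=> ij ij'; apply: alternating_rank1 => //.
  - by rewrite !inE negb_or lo_mid eq_lshift eq_sym ij.
  - rewrite !inE negb_or eq_sym lo_mid eq_rshift (inj_eq perm_inj) eq_lshift.
    by rewrite eq_sym ij'.
set L := (LHS); suff /eqP : L *+ 16 = 0 by rewrite mulrn_eq0 => /eqP.
rewrite /L -sumrMnl.
transitivity (T ord0 ord_max ord0 ord_max - T ord0 ord_max ord_max ord0
  - T ord_max ord0 ord0 ord_max + T ord_max ord0 ord_max ord0); last first.
  by rewrite !T0 // !subr0 addr0.
rewrite -!sumrB -big_split /=; apply: eq_bigr => s _.
move: (aE (fun i => Z (s (lo i)))) (aE (fun i => Z (s (mid t i)))).
rewrite -/(A s) -/(A' t s).
move: (A s) (A' t s) (W t s) (_ ^+ s : R) => x y z e.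
do 4! move: (beta _ _) => ?; move=> xE yE.
have -> : (e * (x * y * z)) *+ 16 = e * ((x *+ 4) * (y *+ 4) * z) by ring.
by rewrite xE yE; ring.
Qed.

Lemma wedge_exp_rank1 (a : kform M 2) k : (1 < k)%N ->
  (forall Z, a Z p *+ 4 =
     beta (Z ord0) (Z ord_max) - beta (Z ord_max) (Z ord0)) ->
  forall Z, wedge_exp a k Z p = 0.
Proof. by case: k => [|[|k]] // _ aE Z; exact: wedge_rank1. Qed.

End Rank1.

End Wedge.

(** * Reduction to the flat case and contradiction with contactness *)

Section Contradiction.
Local Open Scope ring_scope.
Variables (R : realType) (n : nat) (M : manifold R (2 * n + 1)).
Variables (S : contact_metric M) (D : connection M).
Hypothesis n_gt1 : (1 < n)%N.
Local Notation g := (cm_metric S).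
Local Notation xi := (cm_xi S).

(** For [n > 1] the power [(d eta)^n] starts with two factors [d eta], so it vanishes at [p]. *)
Lemma contact_dform_not_rank1 (p : M)
    (beta : vector_field M -> vector_field M -> R) :
  (forall Y Z, dform (cm_eta S) Y Z p *+ 4 = beta Y Z - beta Z Y) ->
  (forall Y Z V W, beta Y Z * beta V W = beta V Z * beta Y W) -> False.
Proof.
move=> dE rank1; have [Z] := cm_contact S p.
rewrite (wedge_right_eq0 _ (b := wedge_exp _ n)) ?eqxx //.
apply: (wedge_exp_rank1 rank1 n_gt1) => Y.
exact: dE.
Qed.

Hypothesis D_LC : levi_civita g D.

Lemma phi_recurrent_flat :
  phi_recurrent (cm_phi S) D -> constant_curvature g D ->
  forall Y Z V, curvature D Y Z V = 0.
Proof.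
move=> [A [W /eqP AW] rec] cc; have par := constant_curvature_parallel D_LC cc.
have [lambda Rg] := cc.
have [p AWp] : exists p, A W p != 0.
  apply: contrapT => nAW; apply: AW; apply: smooth_funP => p.
  by apply/eqP; apply: contrapT => /negP AWp; apply: nAW; exists p.
suff l0 : lambda = 0 by move=> Y Z V; rewrite Rg l0 !scale0r.
apply: contrapT => /eqP l0.
(* With [lambda] nonzero, [A(W) R(Z, xi) xi = 0] makes [g] of rank one at [p]; as [phi] takes values
   orthogonal to [xi], [d eta] vanishes at [p]. *)
have gp Z T : g Z T p = g Z xi p * g xi T p.
  have : g (A W *: curvature D Z xi xi) T = 0.
    by rewrite -rec par !phi0 metric0l.
  rewrite Rg !metricE reeb_unit => /(congr1 (fun f : smooth_fun M => f p)).
  move/eqP; rewrite (_ : _ p = A W p *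
    (lambda * 1 * (1 * g Z T p - g Z xi p * g xi T p))) //.
  rewrite !mulf_eq0 (negPf AWp) (negPf l0) oner_eq0 /= mul1r subr_eq0.
  by move/eqP.
apply: (@contact_dform_not_rank1 p (fun _ _ => 0)) => [Y Z|*]; last first.
  by rewrite !mulr0.
rewrite cm_metric_phi gp phi_orth_reeb.
by rewrite (_ : (0 : smooth_fun M) p = 0) // mulr0 mul0rn subr0.
Qed.

End Contradiction.

Theorem theorem4p3 (R : realType) (n : nat) (hn : 1 < n) :
  ~ exists (M : manifold R (2 * n + 1)) (S : contact_metric M)
      (D : connection M),
      [/\ levi_civita (cm_metric S) D,
          phi_recurrent (cm_phi S) D
        & constant_curvature (cm_metric S) D].
Proof.
case=> M [S [D [D_LC rec cc]]].
have flat := phi_recurrent_flat hn D_LC rec cc.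
have [beta [dE rank1]] := flat_dform_rank1 D_LC flat.
have [p _] := manifold_nonempty M.
apply: (@contact_dform_not_rank1 _ _ _ S hn p (fun Y Z => beta Y Z p)).
  by move=> Y Z; have := congr1 (fun f : smooth_fun M => f p) (dE Y Z).
by move=> Y Z V W; have := congr1 (fun f : smooth_fun M => f p) (rank1 Y Z V W).
Qed.
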